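(* Let $f\colon B^*\to B^*$ be a non-erasing morphism prolongable on a letter $a\in B$, of growth type $(\lambda,d)$ with respect to $a$, and let $g\colon B^*\to A^*$ be a non-erasing morphism such that $g(f^\omega(a))$ is an infinite word. Suppose moreover that $$|g(f(a))|>|g(a)|\quad\text{and}\quad\forall b\in B,\ |g(f(b))|\ge|g(b)|.$$ Define the alphabet $\Pi=\{(b,i)\mid b\in B,\ 0\le i<|g(b)|\}$, the morphism $\alpha\colon B^*\to\Pi^*$, $b\mapsto(b,0)(b,1)\cdots(b,|g(b)|-1)$, and the coding $\tau\colon\Pi^*\to A^*$, $(b,i)\mapsto(g(b))_i$, where $(g(b))_i$ is the letter of $g(b)$ at position $i$ (positions starting from $0$). Then one can choose, for each $b\in B$, a factorization $$\alpha(f(b))=w_{b,0}\,w_{b,1}\cdots w_{b,|g(b)|-1}$$ with $w_{b,i}\in\Pi^+$ for all $i$ and $|w_{a,0}|\ge2$. For any such choice, let $\sigma\colon\Pi^*\to\Pi^*$ be the morphism $(b,i)\mapsto w_{b,i}$. Then $\sigma$ is non-erasing and prolongable on $(a,0)$, $\tau$ is a coding, and $g(f^\omega(a))=\tau(\sigma^\omega((a,0)))$. Moreover, $\mathsf{Mat}_\sigma$ is a dilated matrix of $\mathsf{Mat}_f$, and $\sigma$ has growth type $(\lambda,d)$ with respect to $(a,0)$.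
   Context: Alphabets are finite; $A^*$ is the free monoid of finite words over $A$, with empty word $\varepsilon$, and $A^+=A^*\setminus\{\varepsilon\}$. $|w|$ is the length of $w$ and $|w|_a$ the number of occurrences of the letter $a$ in $w$. Morphisms are monoid morphisms, extended letterwise to infinite words; a morphism is non-erasing if the image of every letter is non-empty, and a coding if the image of every letter has length $1$. A morphism $f\colon B^*\to B^*$ is prolongable on $a\in B$ if $f(a)=au$ for some $u\in B^+$ and $|f^n(a)|\to+\infty$; then $f^\omega(a)=\lim_{n\to\infty}f^n(a)$ denotes the infinite word having all $f^n(a)$ as prefixes. The incidence matrix $\mathsf{Mat}_f\in\mathbb{N}^{B\times B}$ of $f\colon B^*\to B^*$ is defined by $(\mathsf{Mat}_f)_{b,c}=|f(c)|_b$. Growth type: a morphism $f\colon B^*\to B^*$ prolongable on $a$ has growth type $(\lambda,d)$ with respect to $a$ (with $\lambda\ge1$ real, $d\in\mathbb{N}$) if all letters of $B$ occur in $f^\omega(a)$ and $|f^n(a)|=\Theta(n^d\lambda^n)$, i.e. there are constants $c,C>0$ with $c\,n^d\lambda^n\le|f^n(a)|\le C\,n^d\lambda^n$ for all large $n$. Dilated matrix: let $M$ be a real square matrix with rows and columns indexed by a finite set $I$. A real square matrix $D$ is a dilated matrix of $M$ if there exist positive integers $(k_i)_{i\in I}$ such that the rows and columns of $D$ are indexed by pairs $(i,k)$, where $i\in I$ and $k$ ranges over a set of $k_i$ consecutive indices (here $0\le k<k_i$), and for all $i,j\in I$ and all $k$, $\sum_{\ell}D_{(i,k),(j,\ell)}=M_{i,j}$,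 the sum being over the $k_j$ possible values of $\ell$. *)

(* Defs.v *)
From mathcomp Require Import all_boot all_order all_algebra.
From mathcomp Require Import reals.

Set Implicit Arguments.
Unset Strict Implicit.
Unset Printing Implicit Defensive.

Import Order.TTheory GRing.Theory Num.Theory.

(* A monoid morphism B^* -> C^* is represented by its restriction             *)
(* f : B -> seq C to letters, which determines it; [morph f] is the morphism  *)
(* itself.  Infinite words are functions on nat, and [mkseq x n] is the       *)
(* prefix of length n of the infinite word x.                                 *)
Definition morph (B C : Type) (f : B -> seq C) (w : seq B) : seq C :=
  flatten (map f w).

Definition non_erasing (B : Type) (C : eqType) (f : B -> seq C) : Prop :=
  forall b, f b != [::].

Definition coding (B C : Type) (f : B -> seq C) : Prop :=
  forall b, size (f b) = 1.

Definition morph_iter (B : Type) (f : B -> seq B) (n : nat) (a : B) : seq B :=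
  iter n (morph f) [:: a].

Definition prolongable (B : eqType) (f : B -> seq B) (a : B) : Prop :=
  (exists2 u : seq B, u != [::] & f a = a :: u) /\
  (forall m, exists N, forall n, N <= n -> m <= size (morph_iter f n a)).

(* When f is prolongable on a, the i-th iterate has length greater than i, so *)
(* the default value of nth is not used; see [omega_prefix].                  *)
Definition omega (B : Type) (f : B -> seq B) (a : B) : nat -> B :=
  fun i => nth a (morph_iter f i a) i.

(* The image of x under g is an infinite word, and this infinite word is y.   *)
Definition infinite_image (B C : Type) (g : B -> seq C)
    (x : nat -> B) (y : nat -> C) : Prop :=
  (forall n, morph g (mkseq x n) = mkseq y (size (morph g (mkseq x n)))) /\
  (forall m, exists n, m <= size (morph g (mkseq x n))).

Definition incidence (B : eqType) (f : B -> seq B) (b c : B) : nat :=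
  count_mem b (f c).

Definition growth_type (R : realType) (B : Type) (f : B -> seq B) (a : B)
    (lambda : R) (d : nat) : Prop :=
  [/\ (1 <= lambda)%R,
      forall b, exists i, omega f a i = b &
      exists c C : R, [/\ (0 < c)%R, (0 < C)%R &
        exists N, forall n, N <= n ->
          (c * (n%:R ^+ d * lambda ^+ n) <= (size (morph_iter f n a))%:R
             <= C * (n%:R ^+ d * lambda ^+ n))%R]].

(* The sizes k i of the blocks are read off the index type of D, namely the   *)
(* pairs (i, u) with u < k i.                                                 *)
Definition dilated (R : realType) (I : finType) (k : I -> nat)
    (M : I -> I -> R) (D : {i : I & 'I_(k i)} -> {i : I & 'I_(k i)} -> R) :
    Prop :=
  (forall i, 0 < k i) /\
  (forall (i j : I) (u : 'I_(k i)),
     \sum_(l < k j) D (Tagged _ u) (Tagged _ l) = M i j)%R.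

Section PiAlphabet.
Variables (A B : finType) (g : B -> seq A).

Definition Pi_alphabet : finType := {b : B & 'I_(size (g b))}.

Definition Pi_letter (b : B) (i : 'I_(size (g b))) : Pi_alphabet :=
  Tagged (fun b => 'I_(size (g b))) i.

Definition alpha (b : B) : seq Pi_alphabet :=
  [seq Pi_letter i | i : 'I_(size (g b))].

Definition tau (p : Pi_alphabet) : seq A :=
  [:: tnth (in_tuple (g (tag p))) (tagged p)].

Lemma non_erasing_size_gt0 : non_erasing g -> forall b, 0 < size (g b).
Proof. by move=> hg b; rewrite lt0n size_eq0. Qed.

Definition pos0 (hg : non_erasing g) (b : B) : 'I_(size (g b)) :=
  Ordinal (non_erasing_size_gt0 hg b).

Definition Pi_factorization (f : B -> seq B) (hg : non_erasing g) (a : B)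
    (w : forall b, 'I_(size (g b)) -> seq Pi_alphabet) : Prop :=
  [/\ forall b, morph alpha (f b) = flatten [seq w b i | i : 'I_(size (g b))],
      forall b i, w b i != [::] &
      2 <= size (w a (pos0 hg a))].

Definition sigma (w : forall b, 'I_(size (g b)) -> seq Pi_alphabet)
    (p : Pi_alphabet) : seq Pi_alphabet :=
  w (tag p) (tagged p).

End PiAlphabet.

Lemma morph_cat (B C : Type) (f : B -> seq C) (u v : seq B) :
  morph f (u ++ v) = morph f u ++ morph f v.
Proof. by rewrite /morph map_cat flatten_cat. Qed.

Lemma iter_morph_cat (B : Type) (f : B -> seq B) n (u v : seq B) :
  iter n (morph f) (u ++ v) = iter n (morph f) u ++ iter n (morph f) v.
Proof. by elim: n => //= n ->; rewrite morph_cat. Qed.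

Lemma morph_iterS (B : eqType) (f : B -> seq B) (a : B) :
  prolongable f a ->
  forall n, exists2 v, v != [::] &
    morph_iter f n.+1 a = morph_iter f n a ++ v.
Proof.
case=> -[u u0 fa] inf n.
have E m : morph_iter f m.+1 a = morph_iter f m a ++ iter m (morph f) u.
  by rewrite /morph_iter iterSr {2}/morph /= cats0 fa -cat1s iter_morph_cat.
exists (iter n (morph f) u); last exact: E.
apply/eqP => un.
have uk k : iter (k + n) (morph f) u = [::] by elim: k => //= k ->.
have sk k : size (morph_iter f (k + n) a) = size (morph_iter f n a).
  by elim: k => // k IH; rewrite addSn E uk cats0.
have [N /(_ (N + n) (leq_addr _ _))] := inf (size (morph_iter f n a)).+1.
by rewrite sk ltnn.
Qed.

Lemma size_morph_iter (B : eqType) (f : B -> seq B) (a : B) :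
  prolongable f a -> forall n, n < size (morph_iter f n a).
Proof.
move=> pf; elim=> // n IH; have [v v0 ->] := morph_iterS pf n.
by rewrite size_cat -[n.+2]addn1 leq_add // lt0n size_eq0.
Qed.

Lemma omega_prefix (B : eqType) (f : B -> seq B) (a : B) :
  prolongable f a ->
  forall n, morph_iter f n a = mkseq (omega f a) (size (morph_iter f n a)).
Proof.
move=> pf n; apply: (@eq_from_nth _ a); first by rewrite size_mkseq.
move=> i lti.
rewrite nth_mkseq // /omega.
have step k m : i < size (morph_iter f m a) ->
    nth a (morph_iter f (k + m) a) i = nth a (morph_iter f m a) i /\
    i < size (morph_iter f (k + m) a).
  move=> im; elim: k => // k [IH1 IH2].
  have [v _ E] := morph_iterS pf (k + m).
  by rewrite addSn E nth_cat size_cat IH2 IH1 ltn_addr.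
have [<- _] := step i n lti.
by have [<- _] := step n i (size_morph_iter pf i); rewrite addnC.
Qed.

Lemma infinite_image_uniq (B C : Type) (g : B -> seq C) (x : nat -> B)
    (y z : nat -> C) :
  infinite_image g x y -> infinite_image g x z -> y =1 z.
Proof.
case=> [py inf] [pz _] i; have [n lti] := inf i.+1.
have := py n; rewrite {1}pz => /(congr1 (fun s => nth (y i) s i)).
by rewrite !nth_mkseq.
Qed.

(* Main.v *)
Require Import Defs.
From mathcomp Require Import all_boot all_order all_algebra.
From mathcomp Require Import reals.

(* Since sigma \o alpha = alpha \o f, the words sigma^n (a,0) are prefixes of *)
(* alpha (f^n a).  Conversely, once m is so large that alpha a is a prefix of *)
(* sigma^m (a,0), the word alpha (f^n a) is a prefix of sigma^(n + m) (a,0).  *)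
(* Hence both families have the same limit and comparable lengths, and        *)
(* applying tau, with tau \o alpha = g, gives g (f^omega a).                  *)

Set Implicit Arguments.
Unset Strict Implicit.
Unset Printing Implicit Defensive.

Import Order.TTheory GRing.Theory Num.Theory.

(** Concatenating the factors [w b i] turns the factorization into the identity [sigma] o [alpha] =
    [alpha] o [f] ([sigma_alpha]), while [tau] o [alpha] = [g] ([tau_alpha]); everything is
    transported along these two. A factorization exists because [alpha (f b)] is as long as
    [g (f b)], hence has at least [size (g b)] letters, and strictly more for [b = a]
    ([seq_factorization]). For the matrices, a letter [(b, i)] occurs once in [alpha b] and in no
    other [alpha c], so its occurrences in [alpha (f c)] number those of [b] in [f c]
    ([count_mem_morph_alpha]), and a row sum over the block of [c] counts exactly these. For the
    growth type, the mutual prefix relations [sigma_iter_prefix_alpha] and [alpha_prefix_sigma_iter]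
    bound each length by a constant multiple of the other, and [growth_comparable] concludes. *)

(** * Prefixes and factorizations of words *)

Lemma prefix_size_le (T : eqType) (u v w : seq T) :
  prefix u w -> prefix v w -> size u <= size v -> prefix u v.
Proof.
rewrite !prefixE => /eqP uw /eqP vw uv.
by rewrite -[v in take _ v]vw take_takel // uw.
Qed.

Lemma prefix_mkseq (T : eqType) (x : nat -> T) m n :
  m <= n -> prefix (mkseq x m) (mkseq x n).
Proof.
by move=> mn; rewrite /mkseq -(subnKC mn) iotaD map_cat prefix_prefix.
Qed.

Lemma prefix_mkseqE (T : eqType) (x : nat -> T) (u : seq T) n :
  prefix u (mkseq x n) -> u = mkseq x (size u).
Proof.
rewrite prefixE => /eqP <-.
by rewrite -map_take take_iota size_map size_iota.
Qed.

(** Block 0 takes all the surplus letters and every other block is a single letter, so a strict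
    inequality [k < size s] makes block 0 of length at least 2. *)
Lemma seq_factorization (T : Type) (s : seq T) (k : nat) :
  0 < k <= size s ->
  exists w : nat -> seq T,
    [/\ s = flatten [seq w i | i : 'I_k],
        forall i, i < k -> 0 < size (w i) &
        size (w 0) = (size s - k).+1].
Proof.
case: k => // k /= ks; pose sh := (size s - k.+1).+1 :: nseq k 1.
have shs : sumn sh = size s.
  by rewrite /= sumn_nseq mul1n addSnnS subnK.
have sz : size (reshape sh s) = k.+1 by rewrite size_reshape /= size_nseq.
(* Past the last block the two default values agree, since [[::]] has size 0. *)
have nsz i : size (nth [::] (reshape sh s) i) = nth 0 sh i.
  rewrite -{2}(@reshapeKl _ sh s) ?shs // /shape.
  have [lti|gei] := ltnP i (size (reshape sh s)).
    by rewrite (nth_map [::]).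
  by rewrite !nth_default ?size_map.
exists (nth [::] (reshape sh s)); split=> [|i ik|]; last by rewrite nsz.
  rewrite -{1}(@reshapeKr _ sh s) ?shs //; congr flatten.
  rewrite /image_mem (map_comp (nth [::] (reshape sh s)) val) val_enum_ord -sz.
  by rewrite -/(mkseq _ _) mkseq_nth.
by rewrite nsz; case: i ik => //= i ik; rewrite nth_nseq ifT.
Qed.

(** * Lengths and prefixes under iterated morphisms *)

Section Morphisms.
Variables B C : Type.
Implicit Type f : B -> seq C.

Lemma morph_seq1 f b : morph f [:: b] = f b.
Proof. by rewrite /morph /= cats0. Qed.

Lemma morph_cons f b w : morph f (b :: w) = f b ++ morph f w.
Proof. by []. Qed.

Lemma morph_morph (D : Type) (h : C -> seq D) f w :
  morph h (morph f w) = morph (fun b => morph h (f b)) w.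
Proof.
elim: w => // b w IH.
by rewrite !morph_cons morph_cat IH.
Qed.

Lemma size_morph_le f K w :
  (forall b, size (f b) <= K) -> size (morph f w) <= K * size w.
Proof.
move=> fK; elim: w => [|b w IH]; first by rewrite muln0.
by rewrite morph_cons size_cat mulnS leq_add.
Qed.

End Morphisms.

Lemma eq_morph (B C : Type) (f h : B -> seq C) : f =1 h -> morph f =1 morph h.
Proof. by move=> fh w; rewrite /morph (eq_map fh). Qed.

Lemma prefix_morph (B C : eqType) (f : B -> seq C) u v :
  prefix u v -> prefix (morph f u) (morph f v).
Proof. by case/prefixP=> w ->; rewrite morph_cat prefix_prefix. Qed.

Lemma prefix_iter_morph (B : eqType) (f : B -> seq B) n u v :
  prefix u v -> prefix (iter n (morph f) u) (iter n (morph f) v).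
Proof. by move=> uv; elim: n => //= n; apply: prefix_morph. Qed.

Lemma leq_size_morph (B : Type) (C : eqType) (f : B -> seq C) w :
  non_erasing f -> size w <= size (morph f w).
Proof.
move=> f0; elim: w => // b w IH.
by rewrite morph_cons size_cat -[size (b :: w)]add1n leq_add // lt0n size_eq0.
Qed.

Lemma size_iter_morph_le (B : Type) (f : B -> seq B) K n w :
  (forall b, size (f b) <= K) ->
  size (iter n (morph f) w) <= K ^ n * size w.
Proof.
move=> fK; elim: n => [|n IH]; first by rewrite mul1n.
rewrite expnS -mulnA /=.
exact: leq_trans (size_morph_le _ fK) (leq_mul (leqnn K) IH).
Qed.

(** Since f^(n+1)(a) = f^n(a) f^n(u) and f^n(u) is non-empty, each iteration adds at least one
    letter. *)
Lemma non_erasing_prolongable (B : eqType) (f : B -> seq B) a u :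
  non_erasing f -> u != [::] -> f a = a :: u -> prolongable f a.
Proof.
move=> f0 u0 fa; split; first by exists u.
have sz n : n < size (morph_iter f n a).
  elim: n => // n IH.
  rewrite /morph_iter iterSr morph_seq1 fa -cat1s iter_morph_cat size_cat.
  rewrite -addn1 leq_add //.
  elim: n {IH} => [|n IH]; first by rewrite lt0n size_eq0.
  exact: leq_trans IH (leq_size_morph _ f0).
by move=> m; exists m => n mn; exact: leq_trans mn (ltnW (sz n)).
Qed.

Lemma prefix_morph_iter (B : eqType) (f : B -> seq B) a m n :
  prolongable f a -> m <= n -> prefix (morph_iter f m a) (morph_iter f n a).
Proof.
move=> pf /subnKC <-.
elim: (n - m) => [|k IH]; first by rewrite addn0 prefix_refl.
rewrite addnS; have [v _ ->] := morph_iterS pf (m + k).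
exact: prefix_trans IH (prefix_prefix _ _).
Qed.

Lemma prefix_omega (B : eqType) (f : B -> seq B) a n :
  prolongable f a -> prefix (mkseq (omega f a) n) (morph_iter f n a).
Proof.
move=> pf; rewrite (omega_prefix pf); apply: prefix_mkseq.
exact: ltnW (size_morph_iter pf n).
Qed.

Lemma mem_omega (B : eqType) (f : B -> seq B) a b :
  prolongable f a ->
  (exists i, omega f a i = b) <-> (exists n, b \in morph_iter f n a).
Proof.
move=> pf; split=> [[i <-]|[n]].
  by exists i; rewrite mem_nth // size_morph_iter.
by rewrite (omega_prefix pf) => /mapP[i _ ->]; exists i.
Qed.

Lemma growth_comparable (R : realType) (lambda : R) (d : nat)
    (s t : nat -> nat) (K L m : nat) :
  (forall n, t n <= K * s n) -> (forall n, m <= n -> s n <= L * t n) ->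
  (exists c C : R, [/\ (0 < c)%R, (0 < C)%R &
     exists N, forall n, N <= n ->
       (c * (n%:R ^+ d * lambda ^+ n) <= (s n)%:R
          <= C * (n%:R ^+ d * lambda ^+ n))%R]) ->
  exists c C : R, [/\ (0 < c)%R, (0 < C)%R &
     exists N, forall n, N <= n ->
       (c * (n%:R ^+ d * lambda ^+ n) <= (t n)%:R
          <= C * (n%:R ^+ d * lambda ^+ n))%R].
Proof.
move=> ts st [c [C [c0 C0 [N sN]]]].
(* Successors keep both constants positive even if [K] or [L] is 0. *)
exists (c / L.+1%:R)%R, (K.+1%:R * C)%R; split.
- by rewrite divr_gt0 ?ltr0Sn.
- by rewrite mulr_gt0 ?ltr0Sn.
exists (maxn N m) => n; rewrite geq_max => /andP[Nn mn].
have /andP[lo up] := sN n Nn; apply/andP; split.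
  rewrite mulrAC ler_pdivrMr ?ltr0Sn //; apply: (le_trans lo).
  by rewrite -natrM ler_nat mulnC (leq_trans (st n mn)) // leq_mul.
rewrite -mulrA; apply: (@le_trans _ _ (K.+1%:R * (s n)%:R)%R).
  by rewrite -natrM ler_nat (leq_trans (ts n)) // leq_mul.
by rewrite ler_pM2l ?ltr0Sn.
Qed.

(** * The alphabet of positions and the morphism [alpha] *)

Section PiAlphabetTheory.
Variables (A B : finType) (g : B -> seq A).

Lemma size_alpha b : size (alpha g b) = size (g b).
Proof. by rewrite size_map size_enum_ord. Qed.

Lemma size_morph_alpha w : size (morph (alpha g) w) = size (morph g w).
Proof.
elim: w => // b w IH.
by rewrite !morph_cons !size_cat IH size_alpha.
Qed.

Lemma tau_alpha b : morph (tau (g := g)) (alpha g b) = g b.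
Proof.
rewrite /morph /alpha -map_comp.
rewrite (@eq_map _ _ _ (fun i => [:: tnth (in_tuple (g b)) i])) //.
by rewrite (map_comp (fun x => [:: x])) flatten_seq1 map_tnth_enum.
Qed.

Lemma mem_alpha (p : Pi_alphabet g) c : (p \in alpha g c) = (tag p == c).
Proof.
apply/mapP/eqP => [[i _ ->] //|<-].
by exists (tagged p); rewrite ?mem_enum //; case: p.
Qed.

Lemma uniq_alpha b : uniq (alpha g b).
Proof.
rewrite map_inj_uniq ?enum_uniq // => i j /eqP.
by rewrite eq_Tagged => /eqP.
Qed.

Lemma count_mem_morph_alpha (p : Pi_alphabet g) w :
  count_mem p (morph (alpha g) w) = count_mem (tag p) w.
Proof.
elim: w => // b w IH.
rewrite morph_cons count_cat IH count_uniq_mem ?uniq_alpha //.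
by rewrite mem_alpha /= eq_sym.
Qed.

Lemma alpha_pos0 (hg : non_erasing g) b :
  exists v, alpha g b = Pi_letter (pos0 hg b) :: v.
Proof.
exists (behead (alpha g b)).
have: 0 < size (alpha g b) by rewrite size_alpha non_erasing_size_gt0.
have: nth (Pi_letter (pos0 hg b)) (alpha g b) 0 = Pi_letter (pos0 hg b).
  have k0 := non_erasing_size_gt0 hg b.
  rewrite (nth_map (pos0 hg b)) ?size_enum_ord //; congr Pi_letter.
  by apply: val_inj; rewrite /= nth_enum_ord.
by case: (alpha g b) => //= p s ->.
Qed.

(** * The morphism [sigma] given by a factorization *)

Variables (f : B -> seq B) (hg : non_erasing g) (a : B).

Lemma Pi_factorization_exists :
  size (g a) < size (morph g (f a)) ->
  (forall b, size (g b) <= size (morph g (f b))) ->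
  exists w, Pi_factorization f hg a w.
Proof.
move=> gfa gf.
have wP b : exists w : nat -> seq (Pi_alphabet g),
    [/\ morph (alpha g) (f b) = flatten [seq w i | i : 'I_(size (g b))],
        forall i, i < size (g b) -> 0 < size (w i) &
        size (w 0) = (size (morph g (f b)) - size (g b)).+1].
  rewrite -size_morph_alpha; apply: seq_factorization.
  by rewrite non_erasing_size_gt0 //= size_morph_alpha.
have [w {}wP] := fin_all_exists wP.
exists (fun b i => w b (val i)); split=> [b|b i|].
- by have [wE _ _] := wP b; rewrite wE.
- by have [_ w0 _] := wP b; rewrite -size_eq0 -lt0n w0 ?ltn_ord.
- by have [_ _ sw] := wP a; rewrite /= sw ltnS subn_gt0.
Qed.

Variable w : forall b, 'I_(size (g b)) -> seq (Pi_alphabet g).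
Hypothesis hw : Pi_factorization f hg a w.

Lemma sigma_non_erasing : non_erasing (sigma w).
Proof. by case: hw => _ w0 _ p; apply: w0. Qed.

Lemma sigma_alpha b : morph (sigma w) (alpha g b) = morph (alpha g) (f b).
Proof. by case: hw => -> _ _; rewrite /morph /alpha -map_comp. Qed.

Lemma iter_sigma_alpha n u :
  iter n (morph (sigma w)) (morph (alpha g) u) =
    morph (alpha g) (iter n (morph f) u).
Proof.
elim: n => //= n ->; rewrite !morph_morph.
exact: eq_morph sigma_alpha _.
Qed.

Local Notation a0 := (Pi_letter (pos0 hg a)).

(** The word [alpha (f a)] starts with [a0] because [f a] starts with [a]; its first factor is the
    image of [a0], which therefore starts with [a0] and has a further letter by the length condition
    on that factor. *)
Lemma sigma_prolongable : prolongable f a -> prolongable (sigma w) a0.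
Proof.
case=> -[u _ fa] _; case: (hw) => _ _ wa2.
have [v va] := alpha_pos0 hg a.
have: morph (alpha g) (f a) = a0 :: v ++ morph (alpha g) u.
  by rewrite fa morph_cons va.
have -> : morph (alpha g) (f a) = morph (sigma w) (alpha g a).
  by rewrite sigma_alpha.
rewrite va morph_cons /sigma /=.
case wa: (w (pos0 hg a)) wa2 => [|p s] //= s0 [pa _].
apply: (@non_erasing_prolongable _ _ _ s); first exact: sigma_non_erasing.
  by rewrite -size_eq0 -lt0n.
by rewrite /sigma /= wa pa.
Qed.

Hypothesis pf : prolongable f a.

Lemma sigma_iter_prefix_alpha n :
  prefix (morph_iter (sigma w) n a0) (morph (alpha g) (morph_iter f n a)).
Proof.
rewrite /morph_iter -iter_sigma_alpha; apply: prefix_iter_morph.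
by have [v va] := alpha_pos0 hg a; rewrite morph_seq1 va /= eqxx prefix0s.
Qed.

(** For k above n and m, both words are prefixes of [alpha] (f^k(a)), so comparing lengths is
    enough, and the m-th iterate of [sigma] on [a0] is longer than m. *)
Lemma alpha_prefix_sigma_iter n m :
  size (morph (alpha g) (morph_iter f n a)) <= m ->
  prefix (morph (alpha g) (morph_iter f n a)) (morph_iter (sigma w) m a0).
Proof.
move=> nm; have [k [nk mk]] : exists k, n <= k /\ m <= k.
  by exists (maxn n m); rewrite leq_maxl leq_maxr.
apply: (@prefix_size_le _ _ _ (morph (alpha g) (morph_iter f k a))).
- exact/prefix_morph/prefix_morph_iter.
- apply: prefix_trans (sigma_iter_prefix_alpha k).
  exact/prefix_morph_iter/mk/sigma_prolongable.
- exact: leq_trans nm (ltnW (size_morph_iter (sigma_prolongable pf) m)).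
Qed.

Lemma sigma_image (y : nat -> A) :
  infinite_image g (omega f a) y ->
  infinite_image (tau (g := g)) (omega (sigma w) a0) y.
Proof.
case=> gy _; split=> [n|m].
  (* It suffices that the [tau]-image is a prefix of g(f^n(a)), itself a prefix of [y]; applying
     [tau] to [sigma_iter_prefix_alpha] gives this. *)
  apply: (@prefix_mkseqE _ _ _ (size (morph g (morph_iter f n a)))).
  have <- : morph g (morph_iter f n a) =
      mkseq y (size (morph g (morph_iter f n a))).
    by have := gy (size (morph_iter f n a)); rewrite -omega_prefix.
  rewrite -(eq_morph tau_alpha) -morph_morph; apply: prefix_morph.
  apply: prefix_trans (sigma_iter_prefix_alpha n).
  exact/prefix_omega/sigma_prolongable.
exists m; apply: leq_trans (leq_size_morph _ _); first by rewrite size_mkseq.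
by move=> p.
Qed.

Lemma sigma_dilated (R : realType) :
  dilated (k := fun b => size (g b))
    (fun b c => (incidence f b c)%:R%R : R)
    (fun p q : Pi_alphabet g => (incidence (sigma w) p q)%:R%R : R).
Proof.
split=> [b|b c u]; first exact: non_erasing_size_gt0.
rewrite -natr_sum /incidence; congr (_%:R)%R.
case: hw => wE _ _.
rewrite -(count_mem_morph_alpha (Pi_letter u)) wE count_flatten -map_comp.
by rewrite sumnE big_map big_enum.
Qed.

Lemma sigma_growth (R : realType) (lambda : R) (d : nat) :
  growth_type f a lambda d -> growth_type (sigma w) a0 lambda d.
Proof.
case=> lambda1 occ growth.
pose m := size (alpha g a).
pose K := \max_b size (g b); pose L := \max_b size (f b).
have leK b : size (alpha g b) <= K by rewrite size_alpha (leq_bigmax b).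
have leL b : size (f b) <= L by rewrite (leq_bigmax b).
split=> // [p|].
  (* If [tag p] occurs in f^n(a), then [p] occurs in its [alpha]-image, which is a prefix of some
     iterate of [sigma] on [a0]. *)
  have [n pn] := (mem_omega (tag p) pf).1 (occ (tag p)).
  apply/(mem_omega p (sigma_prolongable pf)).
  exists (size (morph (alpha g) (morph_iter f n a))).
  have /prefixP[v ->] := alpha_prefix_sigma_iter (leqnn (size
    (morph (alpha g) (morph_iter f n a)))).
  rewrite mem_cat; apply/orP; left.
  by rewrite -has_pred1 has_count count_mem_morph_alpha -has_count has_pred1.
apply: (growth_comparable (K := K) (L := L ^ m) (m := m)) growth => [n|n mn].
  apply: leq_trans (size_morph_le _ leK).
  exact/size_prefix/sigma_iter_prefix_alpha.
(* The last [m] applications of [f] cost a factor [L ^ m]. What remains, f^(n-m)(a), is no longer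
   than its [alpha]-image, which is sigma^(n-m) of [alpha a]; as [alpha a] is a prefix of
   sigma^m(a0), this is a prefix of sigma^n(a0). *)
rewrite /morph_iter -(subnKC mn) iterD.
apply: leq_trans (size_iter_morph_le _ _ leL) _.
rewrite leq_mul2l; apply/orP; right.
apply: leq_trans (leq_size_morph _ (_ : non_erasing (alpha g))) _ => [b|].
  by rewrite -size_eq0 size_alpha size_eq0.
rewrite -iter_sigma_alpha addnC iterD.
apply/size_prefix/prefix_iter_morph.
by apply: (@alpha_prefix_sigma_iter 0); rewrite /= morph_seq1.
Qed.

End PiAlphabetTheory.

Theorem proposition44 (R : realType) (A B : finType)
    (f : B -> seq B) (a : B) (lambda : R) (d : nat) (g : B -> seq A)
    (f_non_erasing : non_erasing f)
    (f_prolongable : prolongable f a)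
    (f_growth : growth_type f a lambda d)
    (g_non_erasing : non_erasing g)
    (y : nat -> A) (y_image : infinite_image g (omega f a) y)
    (g_f_a : size (g a) < size (morph g (f a)))
    (g_f : forall b : B, size (g b) <= size (morph g (f b))) :
  let a0 : Pi_alphabet g := Pi_letter (pos0 g_non_erasing a) in
  (exists w : forall b : B, 'I_(size (g b)) -> seq (Pi_alphabet g),
     Pi_factorization f g_non_erasing a w) /\
  (forall w : forall b : B, 'I_(size (g b)) -> seq (Pi_alphabet g),
     Pi_factorization f g_non_erasing a w ->
     (non_erasing (sigma w) /\ prolongable (sigma w) a0) /\
     coding (tau (g := g)) /\
     infinite_image (tau (g := g)) (omega (sigma w) a0) y /\
     dilated (k := fun b : B => size (g b))
       (fun b c : B => (incidence f b c)%:R%R : R)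
       (fun p q : Pi_alphabet g => (incidence (sigma w) p q)%:R%R : R) /\
     growth_type (sigma w) a0 lambda d).
Proof.
move=> a0; split; first exact: Pi_factorization_exists.
move=> w hw; split; first by split;
  [exact: sigma_non_erasing hw | exact: sigma_prolongable hw f_prolongable].
split=> //; split; first exact: (sigma_image hw f_prolongable y_image).
split; first exact: sigma_dilated hw R.
exact: (sigma_growth hw f_prolongable f_growth).
Qed.
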